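(* Let $\mathcal X$ be a zero-nonzero pattern and let $k=\operatorname{tri}(\mathcal X)$. If $\operatorname{mr}\mathcal R(\mathcal X)>k$, then every matroid $M\in\mathcal R(\mathcal X^T)$ of rank $k$ fails to have an adjoint.
   Context: A zero-nonzero pattern is a matrix with entries in $\{0,*\}$; the zero set of a row is the set of column labels where it has entry $0$. For a pattern $\mathcal Y$, $\mathcal R(\mathcal Y)$ is the set of matroids on the set of column labels of $\mathcal Y$ such that the zero set of each row is a flat; $\operatorname{mr}\mathcal R(\mathcal Y)$ is the smallest rank of a matroid in it. A square pattern is a triangle if its rows and columns can be permuted (independently) to give a lower triangular pattern with all diagonal entries $*$. The triangle number $\operatorname{tri}(\mathcal X)$ is the largest $k$ such that some $k\times k$ submatrix of $\mathcal X$ is a triangle. A simple matroid $M'$ is an adjoint of $M$ if $r(M')=r(M)$ and there is a map $\phi$ from the lattice of flats of $M$ to that of $M'$ which is injective, inclusion-reversing, and restricts to a bijection from the hyperplanes of $M$ onto the rank-$1$ flats of $M'$. *)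

(* Defs.v *)
From HB Require Import structures.
From mathcomp Require Import all_boot all_order all_fingroup all_algebra.

Set Implicit Arguments.
Unset Strict Implicit.
Unset Printing Implicit Defensive.

Section MatroidDef.
Variable T : finType.
Implicit Types (I : {set {set T}}) (A B : {set T}).

Definition matroid_axioms I : bool :=
  [&& set0 \in I,
      [forall B in I, forall A : {set T}, (A \subset B) ==> (A \in I)] &
      [forall A in I, forall B in I,
         (#|A| < #|B|) ==> [exists x in B :\: A, x |: A \in I]]].

Record matroid := Matroid {
  indeps : {set {set T}};
  indepsP : matroid_axioms indeps
}.

HB.instance Definition _ := [isSub for indeps].
HB.instance Definition _ := [Finite of matroid by <:].

Lemma free_matroid_axioms : matroid_axioms [set: {set T}].
Proof.
apply/and3P; split; first by rewrite inE.
  by apply/forall_inP => B _; apply/forallP => A; rewrite inE implybT.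
apply/forall_inP => A _; apply/forall_inP => B _; apply/implyP => ltAB.
have /card_gt0P[x xBA] : 0 < #|B :\: A|.
  rewrite cardsD subn_gt0; apply: leq_ltn_trans ltAB.
  by rewrite subset_leq_card // subsetIr.
by apply/exists_inP; exists x => //; rewrite inE.
Qed.

Definition free_matroid : matroid := Matroid free_matroid_axioms.

End MatroidDef.

Section MatroidTheory.
Variables (T : finType) (M : matroid T).
Implicit Types (A F H : {set T}).

Definition rank A : nat := \max_(B in indeps M | B \subset A) #|B|.

Definition mrank : nat := rank [set: T].

Definition flat F : bool := [forall x, (x \notin F) ==> (rank F < rank (x |: F))].

Definition flats : {set {set T}} := [set F | flat F].

Definition hyperplanes : {set {set T}} :=
  [set H in flats | (rank H).+1 == mrank].

Definition rank1_flats : {set {set T}} := [set F in flats | rank F == 1].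

(* No loops and no pairs of parallel elements. *)
Definition simple : bool := [forall x, forall y, [set x; y] \in indeps M].

End MatroidTheory.

(* [phi] is total, but only its values on the flats of [M] matter.  The last
   clause, with injectivity on all flats, says that [phi] restricts to a
   bijection from the hyperplanes of [M] onto the rank-1 flats of [M']. *)
Definition adjoint (T T' : finType) (M : matroid T) (M' : matroid T') : Prop :=
  [/\ simple M', mrank M' = mrank M &
      exists phi : {set T} -> {set T'},
        [/\ {in flats M, forall F, phi F \in flats M'},
            {in flats M &, injective phi},
            {in flats M &, forall F G : {set T},
               F \subset G -> phi G \subset phi F} &
            phi @: hyperplanes M = rank1_flats M']].

Definition has_adjoint (T : finType) (M : matroid T) : Prop :=
  exists (T' : finType) (M' : matroid T'), adjoint M M'.

(* Entry [true] stands for [*] and [false] for [0]; the column labels of an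
   [m x n] pattern are the elements of ['I_n]. *)
Definition pattern (m n : nat) := 'M[bool]_(m, n).

Definition zero_set (m n : nat) (Y : pattern m n) (i : 'I_m) : {set 'I_n} :=
  [set j | ~~ Y i j].

Definition matroids_of (m n : nat) (Y : pattern m n) : {set matroid 'I_n} :=
  [set M | [forall i, zero_set Y i \in flats M]].

Lemma rank_free (T : finType) (A : {set T}) : rank (free_matroid T) A = #|A|.
Proof.
apply/eqP; rewrite eqn_leq; apply/andP; split.
  by apply/bigmax_leqP => B /andP[_ /subset_leq_card].
by apply: (bigmax_sup A) => //; rewrite inE subxx.
Qed.

Lemma free_matroid_in (m n : nat) (Y : pattern m n) :
  free_matroid 'I_n \in matroids_of Y.
Proof.
rewrite inE; apply/forallP => i; rewrite inE; apply/forallP => x.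
by apply/implyP => xF; rewrite !rank_free cardsU1 xF.
Qed.

(* The default value of the [arg min] is never used, since the free matroid
   belongs to [matroids_of Y]. *)
Definition mr (m n : nat) (Y : pattern m n) : nat :=
  mrank [arg min_(M < free_matroid 'I_n in matroids_of Y) mrank M].

Lemma mr_min (m n : nat) (Y : pattern m n) :
  (exists2 M, M \in matroids_of Y & mrank M = mr Y) /\
  {in matroids_of Y, forall M, mr Y <= mrank M}.
Proof.
rewrite /mr; case: arg_minnP => [|M MY minM]; first exact: free_matroid_in.
by split; first by exists M.
Qed.

Definition lower_triangular_star (k : nat) (B : pattern k k) : bool :=
  [forall i, B i i] &&
  [forall i : 'I_k, forall j : 'I_k, (i < j) ==> ~~ B i j].

Definition triangle (k : nat) (B : pattern k k) : bool :=
  [exists s : 'S_k, exists t : 'S_k,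
     lower_triangular_star (row_perm s (col_perm t B))].

Definition increasing (k n : nat) (f : {ffun 'I_k -> 'I_n}) : bool :=
  [forall i : 'I_k, forall j : 'I_k, (i < j) ==> (f i < f j)].

Definition has_triangle (m n : nat) (X : pattern m n) (k : nat) : bool :=
  [exists f : {ffun 'I_k -> 'I_m}, exists g : {ffun 'I_k -> 'I_n},
     [&& increasing f, increasing g & triangle (mxsub f g X)]].

Definition tri (m n : nat) (X : pattern m n) : nat :=
  \max_(k < (minn m n).+1 | has_triangle X k) k.

(* Main.v *)
Require Import Defs.
From mathcomp Require Import all_boot all_order all_fingroup all_algebra.
From mathcomp Require Import zify.

Set Implicit Arguments.
Unset Strict Implicit.
Unset Printing Implicit Defensive.

(** Let [M'] be an adjoint of [M], through [phi].  Comparing ranks along chains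
    of flats, [phi] turns rank into corank, and therefore [phi F] is contained in
    [phi (closure {i})] exactly when [i] lies in [F].  Place every column [j] of
    the pattern freely on the flat [phi (Z j)] of [M'], where [Z j] is the zero
    set of the column: the matroid obtained has rank at most [r(M') = r(M)], and
    the zero set of row [i] consists of the columns placed inside the flat
    [phi (closure {i})], so it is a flat.  Hence the minimum rank for [X] is at
    most [r(M)].

    "Placed freely" is realised as the Edmonds matroid of the submodular function
    sending a set [A] of columns to the rank of the union of the flats
    [phi (Z j)], [j] in [A]. *)

(** * Rank, flats and closure in a matroid *)

Section MatroidRank.
Variables (T : finType) (M : matroid T).
Implicit Types (A B F G I : {set T}).

Lemma indep0 : set0 \in indeps M.
Proof. by case/and3P: (indepsP M). Qed.

Lemma indep_sub A B : B \in indeps M -> A \subset B -> A \in indeps M.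
Proof.
case/and3P: (indepsP M) => _ /forall_inP sub _ BM AB.
by have /forallP/(_ A)/implyP := sub B BM; apply.
Qed.

Lemma indep_augment A B : A \in indeps M -> B \in indeps M -> #|A| < #|B| ->
  exists2 x, x \in B :\: A & x |: A \in indeps M.
Proof.
case/and3P: (indepsP M) => _ _ /forall_inP aug AM BM ltAB.
have /forall_inP/(_ B BM)/implyP/(_ ltAB)/exists_inP[x xBA xA] := aug A AM.
by exists x.
Qed.

Lemma indep_leq_rank I A : I \in indeps M -> I \subset A -> #|I| <= rank M A.
Proof. by move=> IM IA; apply: (bigmax_sup I); rewrite ?IM. Qed.

Lemma rank_basis A : exists2 B, B \in indeps M & B \subset A /\ #|B| = rank M A.
Proof.
have ex : 0 < #|[pred B | (B \in indeps M) && (B \subset A)]|.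
  by apply/card_gt0P; exists set0; rewrite inE indep0 sub0set.
have [B /[!inE]/andP[BM BA] eqB] := eq_bigmax_cond (fun B => #|B|) ex.
by exists B => //; split; rewrite // /rank -eqB.
Qed.

Lemma indep_extend I A : I \in indeps M -> I \subset A ->
  exists2 B, B \in indeps M & [/\ I \subset B, B \subset A & #|B| = rank M A].
Proof.
move=> IM IA; have [n le_n] := ubnP (rank M A - #|I|).
elim: n => // n IHn in I IM IA le_n *.
have := indep_leq_rank IM IA; rewrite leq_eqVlt => /orP[/eqP eqI | ltI].
  by exists I.
have [B BM [BA cB]] := rank_basis A.
rewrite -cB in ltI; have [x /setDP[xB xI] xIM] := indep_augment IM BM ltI.
have xIA : x |: I \subset A by rewrite subUset sub1set (subsetP BA).
have [|C CM [xIC CA cC]] := IHn _ xIM xIA.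
  by move: le_n; rewrite cardsU1 xI -cB; lia.
by exists C => //; split=> //; apply: subset_trans xIC; apply: subsetUr.
Qed.

Lemma rank_mono A B : A \subset B -> rank M A <= rank M B.
Proof.
move=> AB; have [I IM [IA <-]] := rank_basis A.
exact: indep_leq_rank (subset_trans IA AB).
Qed.

Lemma rank0 : rank M set0 = 0.
Proof.
have [I _ [+ <-]] := rank_basis set0.
by rewrite subset0 => /eqP->; rewrite cards0.
Qed.

(** A basis [I] of the intersection extends to a basis [K] of the union; the traces of [K] on [A]
    and on [B] are independent and share at least [I]. *)
Lemma rank_submod A B :
  rank M (A :|: B) + rank M (A :&: B) <= rank M A + rank M B.
Proof.
have [I IM [IAB <-]] := rank_basis (A :&: B).
have [|K KM [IK KAB <-]] := @indep_extend I (A :|: B) IM.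
  by apply: subset_trans IAB _; rewrite subIset // subsetUl.
have leA : #|K :&: A| <= rank M A.
  by apply: indep_leq_rank (subsetIr _ _); apply: indep_sub KM (subsetIl _ _).
have leB : #|K :&: B| <= rank M B.
  by apply: indep_leq_rank (subsetIr _ _); apply: indep_sub KM (subsetIl _ _).
have leI : #|I| <= #|K :&: A :&: (K :&: B)|.
  by rewrite -setIIr subset_leq_card // subsetI IK.
have := cardsUI (K :&: A) (K :&: B); rewrite -setIUr (setIidPl KAB); lia.
Qed.

Lemma rankU1_leq x A : rank M (x |: A) <= (rank M A).+1.
Proof.
have := rank_submod [set x] A.
have [I _ [/subset_leq_card]] := rank_basis [set x]; rewrite cards1; lia.
Qed.

(** Diminishing returns: by submodularity, an element that raises the rank of [F] raises that of
    every subset of [F]. *)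
Lemma flat_rank_lt F A x : flat M F -> A \subset F -> x \notin F ->
  rank M A < rank M (x |: A).
Proof.
move=> /forallP/(_ x)/implyP fF AF xF; move: (fF xF) => ltF.
have := rank_submod (x |: A) F; rewrite -setUA (setUidPr AF).
have/rank_mono : A \subset (x |: A) :&: F by rewrite subsetI subsetUr.
lia.
Qed.

Lemma flat_proper_rank F G : flat M F -> F \proper G -> rank M F < rank M G.
Proof.
move=> fF /properP[FG [x xG xF]]; apply: leq_trans (flat_rank_lt fF _ xF) _ => //.
by apply: rank_mono; rewrite subUset sub1set xG.
Qed.

(** Both flats are spanned by [A]. This is how two flats are later recognised as the same join. *)
Lemma eq_flat_rank F G A : flat M F -> flat M G -> A \subset F -> A \subset G ->
  rank M F <= rank M A -> rank M G <= rank M A -> F = G.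
Proof.
suff sub F1 G1 : flat M G1 -> A \subset F1 -> A \subset G1 ->
    rank M F1 <= rank M A -> F1 \subset G1.
  by move=> *; apply/eqP; rewrite eqEsubset; apply/andP; split; apply: sub.
move=> fG AF AG leF; apply/subsetP => x xF; apply/idPn => xG.
have := flat_rank_lt fG AG xG; apply/negP; rewrite -leqNgt.
by apply: leq_trans leF; apply: rank_mono; rewrite subUset sub1set xF.
Qed.

Definition closure A : {set T} := [set x | rank M (x |: A) == rank M A].

Lemma sub_closure A : A \subset closure A.
Proof. by apply/subsetP => x xA; rewrite inE (setUidPr _) ?sub1set. Qed.

Lemma rank_closure A : rank M (closure A) = rank M A.
Proof.
suff /eqP : rank M (A :|: closure A) == rank M A.
  by rewrite (setUidPr (sub_closure A)).
(* By submodularity, the sets adding no rank to [A] are stable under union, so it is enough to look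
   at singletons. *)
pose P B := rank M (A :|: B) == rank M A.
suff PU B C : P B -> P C -> P (B :|: C).
  have -> : closure A = \bigcup_(x in closure A) [set x].
    apply/setP=> x; apply/idP/bigcupP => [xA|[y yA /set1P->//]].
    by exists x; rewrite ?set11.
  apply: (big_ind P); rewrite /P ?setU0 //.
  by move=> x; rewrite setUC inE.
rewrite /P setUUr => /eqP PB /eqP PC; have := rank_submod (A :|: B) (A :|: C).
have := @rank_mono A ((A :|: B) :&: (A :|: C)); rewrite subsetI !subsetUl.
have := @rank_mono A (A :|: B :|: (A :|: C)); rewrite -setUA subsetUl.
by move=> /(_ isT) ? /(_ isT) ? ?; apply/eqP; lia.
Qed.

Lemma flat_closure A : flat M (closure A).
Proof.
apply/forallP => x; apply/implyP; rewrite inE rank_closure => ne.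
have := rank_mono (setUS [set x] (sub_closure A)).
have := rank_mono (subsetUr [set x] A).
by lia.
Qed.

Lemma closure_min A F : flat M F -> A \subset F -> closure A \subset F.
Proof.
move=> fF AF; apply/subsetP => x; rewrite inE => /eqP eqA; apply/idPn => xF.
by have := flat_rank_lt fF AF xF; rewrite eqA ltnn.
Qed.

Lemma closure_flat F : flat M F -> closure F = F.
Proof. by move=> fF; apply/eqP; rewrite eqEsubset closure_min ?sub_closure. Qed.

Lemma closureS A B : A \subset B -> closure A \subset closure B.
Proof.
by move=> AB; rewrite closure_min ?flat_closure // (subset_trans AB) ?sub_closure.
Qed.

Lemma closure_proper A x : rank M A < rank M (x |: A) ->
  closure A \proper closure (x |: A).
Proof.
move=> ltA; rewrite properEneq closureS ?subsetUr // andbT.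
by apply: contraTneq ltA => e; rewrite -rank_closure e rank_closure ltnn.
Qed.

Lemma closureU1_id A x : rank M (x |: A) = rank M A ->
  closure (x |: A) = closure A.
Proof.
move=> eqA; apply/eqP; rewrite eqEsubset [X in _ && X]closureS ?subsetUr //.
by rewrite closure_min ?flat_closure // subUset sub1set inE eqA eqxx sub_closure.
Qed.

End MatroidRank.

(** * Inclusion-reversing injections between lattices of flats *)

Section FlatReversal.
Variables (T T' : finType) (M : matroid T) (M' : matroid T').
Variable phi : {set T} -> {set T'}.
Hypothesis eq_mrank : mrank M' = mrank M.
Hypothesis phi_flat : {in flats M, forall F, phi F \in flats M'}.
Hypothesis phi_inj : {in flats M &, injective phi}.
Hypothesis phi_rev : {in flats M &, forall F G : {set T},
  F \subset G -> phi G \subset phi F}.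
Implicit Types (A F G : {set T}).

Let flat_phi F : flat M F -> flat M' (phi F).
Proof. by move=> fF; have := phi_flat (x := F); rewrite !inE; apply. Qed.

Let phi_sub F G : flat M F -> flat M G -> F \subset G -> phi G \subset phi F.
Proof. by move=> fF fG; apply: phi_rev; rewrite inE. Qed.

Let phi_proper F G : flat M F -> flat M G -> F \proper G ->
  phi G \proper phi F.
Proof.
move=> fF fG; rewrite !properEneq => /andP[neq FG].
rewrite phi_sub // andbT; apply: contraNneq neq => /phi_inj e.
by rewrite e // inE.
Qed.

Let fcl A : flat M (closure M A) := flat_closure M A.

(** Build [A] up from the empty set: whenever the rank of [A] grows, by exactly one, the image flat
    shrinks strictly and loses at least one. *)
Lemma rank_phi_closure_leq A :
  rank M' (phi (closure M A)) + rank M A <= mrank M.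
Proof.
have [n le_n] := ubnP #|A|; elim: n => // n IHn in A le_n *.
have [->|[x xA]] := set_0Vmem A.
  by rewrite rank0 addn0 -eq_mrank rank_mono ?subsetT.
have /IHn IH : #|A :\ x| < n by move: le_n; rewrite (cardsD1 x) xA.
move: IH; rewrite -{3 4}(setD1K xA); set B := A :\ x => IH.
have := rank_mono M (subsetUr [set x] B).
rewrite leq_eqVlt => /orP[/eqP eqB | ltB].
  by rewrite closureU1_id // -eqB.
have := flat_proper_rank (flat_phi (fcl _))
  (phi_proper (fcl _) (fcl _) (closure_proper ltB)).
have := rankU1_leq M x B; lia.
Qed.

(** The same comparison, run downwards from the full set, where the rank of [A] alone reaches
    [mrank M]. *)
Lemma rank_phi_closure_geq A :
  mrank M <= rank M' (phi (closure M A)) + rank M A.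
Proof.
have [n le_n] := ubnP #|~: A|; elim: n => // n IHn in A le_n *.
have [A0|[x]] := set_0Vmem (~: A).
  by rewrite -[X in rank M X]setCK A0 setC0 leq_addl.
rewrite inE => xA; have /IHn IH : #|~: (x |: A)| < n.
  by move: le_n; rewrite (cardsD1 x) inE xA setCU setIC -setDE.
have := rank_mono M (subsetUr [set x] A).
rewrite leq_eqVlt => /orP[/eqP eqA | ltA].
  by move: IH; rewrite closureU1_id // -eqA.
have := flat_proper_rank (flat_phi (fcl _))
  (phi_proper (fcl _) (fcl _) (closure_proper ltA)).
have := rankU1_leq M x A; lia.
Qed.

Lemma rank_phi_closure A :
  rank M' (phi (closure M A)) + rank M A = mrank M.
Proof.
by apply/eqP; rewrite eqn_leq rank_phi_closure_leq rank_phi_closure_geq.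
Qed.

(* Downward induction on [A], from [A = F].  When [x] in [F] enlarges the span of
   [A], the flats [phi (closure (x |: A))] and [phi (closure (p |: A))] have equal
   rank, and if both contained [phi F] then each would be the join of [phi F] and
   [phi (closure (p |: (x |: A)))], contradicting injectivity. *)
Lemma phi_closureU1_not_sub F A p : flat M F -> A \subset F -> p \notin F ->
  ~~ (phi F \subset phi (closure M (p |: A))).
Proof.
move=> fF AF pF; have [n le_n] := ubnP #|F :\: A|.
elim: n => // n IHn in A AF le_n *.
have [FA0|[x /setDP[xF xA]]] := set_0Vmem (F :\: A).
  have -> : A = F by apply/eqP; rewrite eqEsubset AF -setD_eq0 FA0 eqxx.
  have := flat_rank_lt fF (subxx F) pF => /closure_proper.
  rewrite (closure_flat fF) => /(phi_proper fF (fcl _)).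
  by rewrite properE => /andP[].
have xAF : x |: A \subset F by rewrite subUset sub1set xF.
have IH : ~~ (phi F \subset phi (closure M (p |: (x |: A)))).
  apply: IHn => //.
  by move: le_n; rewrite (cardsD1 x) inE xA xF setDDl setUC.
have := rank_mono M (subsetUr [set x] A).
rewrite leq_eqVlt => /orP[/eqP eqA | ltA].
  (* An [x] spanned by [A] is also spanned by [p |: A], so [IH] already speaks of the right flat. *)
  suff eqpA : closure M (x |: (p |: A)) = closure M (p |: A).
    by move: IH; rewrite setUCA eqpA.
  apply: closureU1_id.
  have := rank_submod M (x |: A) (p |: A).
  rewrite -setUUl -setUA -eqA.
  have := @rank_mono _ M A ((x |: A) :&: (p |: A)).
  rewrite subsetI !subsetUr => /(_ isT).
  have := rank_mono M (subsetUr [set x] (p |: A)).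
  by lia.
apply: contraNN IH => FpA.
have ltpA := flat_rank_lt fF AF pF.
have ltpxA := flat_rank_lt fF xAF pF.
have [lexA lepA] := (rankU1_leq M x A, rankU1_leq M p A).
apply/idPn => FpxA.
pose P := phi (closure M (p |: (x |: A))).
have ltU : rank M' P < rank M' (phi F :|: P).
  apply: flat_proper_rank; first exact: flat_phi.
  by rewrite properE subsetUr subUset subxx andbT.
have PxA : P \subset phi (closure M (x |: A)).
  by rewrite phi_sub // closureS ?subsetUr.
have PpA : P \subset phi (closure M (p |: A)).
  by rewrite phi_sub // closureS // setUS ?subsetUr.
have FxA : phi F \subset phi (closure M (x |: A)).
  by rewrite phi_sub // closure_min.
have rP := rank_phi_closure (p |: (x |: A)).
have rxA := rank_phi_closure (x |: A).
have rpA := rank_phi_closure (p |: A).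
have lepxA := rankU1_leq M p (x |: A).
rewrite -/P in rP.
(* If [A] has rank r, then [P] has corank r + 2 and both flats have corank r + 1. By [ltU],
   [phi F :|: P] has at least their rank, so it spans each of them. *)
have /phi_inj eq_cl : phi (closure M (x |: A)) = phi (closure M (p |: A)).
  apply: (@eq_flat_rank _ M' _ _ (phi F :|: P)); rewrite ?flat_phi ?subUset ?FxA
    ?FpA //; lia.
move/negP: pF; apply; apply: (subsetP (closure_min fF xAF)).
rewrite eq_cl ?inE // ?fcl //.
by have /subsetP/(_ p) := sub_closure M (p |: A); rewrite !inE eqxx; apply.
Qed.

Lemma phi_sub_closure1 F p : flat M F ->
  (phi F \subset phi (closure M [set p])) = (p \in F).
Proof.
move=> fF; apply/idP/idP => [|pF].
  by apply: contraTT => /(phi_closureU1_not_sub fF (sub0set F)); rewrite setU0.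
by rewrite phi_sub // closure_min ?sub1set.
Qed.

End FlatReversal.

(** * The matroid of a monotone submodular function *)

Section EdmondsMatroid.
Variables (T : finType) (f : {set T} -> nat).
Hypothesis f0 : f set0 = 0.
Hypothesis f_mono : forall A B : {set T}, A \subset B -> f A <= f B.
Hypothesis f_submod : forall A B : {set T}, f (A :|: B) + f (A :&: B) <= f A + f B.
Implicit Types (A B I J : {set T}).

Definition edmonds_indeps : {set {set T}} :=
  [set I : {set T} | [forall J : {set T}, (J \subset I) ==> (#|J| <= f J)]].

Lemma edmonds_indepP I :
  reflect (forall J, J \subset I -> #|J| <= f J) (I \in edmonds_indeps).
Proof.
rewrite inE; apply: (iffP forallP) => [h J | h J]; last exact/implyP/h.
exact/implyP.
Qed.

(** A violating set [J] must contain [x], and then #|J| - 1 <= f (J :\ x) <= f J < #|J| forces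
    equality in the first two places. *)
Lemma edmonds_tightU1 I x : I \in edmonds_indeps -> x \notin I ->
  x |: I \notin edmonds_indeps ->
  exists2 J : {set T}, J \subset I & #|J| = f J /\ f (x |: J) = f J.
Proof.
move=> /edmonds_indepP indI xI; rewrite inE negb_forall => /existsP[J].
rewrite negb_imply -ltnNge => /andP[JxI ltJ].
have JI : J :\ x \subset I by rewrite subDset.
have le := indI _ JI; exists (J :\ x) => //.
have xJ : x \in J.
  apply: contraTT ltJ => xJ; rewrite -leqNgt indI //.
  by apply/subsetP => y yJ; have /setU1P[e|//] := subsetP JxI y yJ; rewrite -e yJ in xJ.
have := f_mono (subsetDl J [set x]).
by rewrite setD1K //; move: ltJ; rewrite (cardsD1 x) xJ; lia.
Qed.

Lemma edmonds_matroid_axioms : matroid_axioms edmonds_indeps.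
Proof.
apply/and3P; split.
- by apply/edmonds_indepP => J; rewrite subset0 => /eqP->; rewrite cards0.
- apply/forall_inP => B /edmonds_indepP indB; apply/forallP => A; apply/implyP => AB.
  by apply/edmonds_indepP => J JA; apply/indB/(subset_trans JA).
apply/forall_inP => A indA; apply/forall_inP => B indB; apply/implyP.
apply: contraLR; rewrite negb_exists -leqNgt => /forallP noaug.
have leA := edmonds_indepP _ indA; have leB := edmonds_indepP _ indB.
(* [J] is the largest tight subset of [A]; every [x] in [B :\: A] lies in its span. *)
pose tight (J : {set T}) := (J \subset A) && (#|J| == f J).
(* Independence of [A] bounds [f] below by cardinality on the union and the intersection;
   submodularity leaves no slack. *)
have tightU (J K : {set T}) : tight J -> tight K -> tight (J :|: K).
  move=> /andP[JA /eqP eJ] /andP[KA /eqP eK].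
  have JKA : J :|: K \subset A by rewrite subUset JA.
  have := leA _ JKA; have := leA (J :&: K) (subset_trans (subsetIl _ _) JA).
  have := f_submod J K; have := cardsUI J K.
  by rewrite /tight JKA /= eqn_leq; lia.
pose J := \bigcup_(K | tight K) K.
have tJ : tight J.
  by apply: (big_ind tight) => //; rewrite /tight sub0set cards0 f0.
have [JA /eqP eJ] := andP tJ.
have spanU (C D : {set T}) : f (J :|: C) = f J -> f (J :|: D) = f J -> f (J :|: (C :|: D)) = f J.
  move=> eC eD; have := f_submod (J :|: C) (J :|: D); rewrite -setUUr.
  have : f J <= f ((J :|: C) :&: (J :|: D)) by rewrite f_mono // subsetI !subsetUl.
  have : f J <= f (J :|: (C :|: D)) by rewrite f_mono // subsetUl.
  by lia.
have spanB : f (J :|: (B :\: A)) = f J.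
  have -> : B :\: A = \bigcup_(x in B :\: A) [set x].
    apply/setP => x; apply/idP/bigcupP => [xBA|[y yBA /set1P->//]].
    by exists x; rewrite ?set11.
  apply: (big_ind (fun C => f (J :|: C) = f J)) => [||x xBA]; first by rewrite setU0.
    exact: spanU.
  have /setDP[xB xA] := xBA; have := noaug x; rewrite xBA /= => nx.
  (* The failed augmentation yields a tight [K] spanning [x]; as [K] lies in [J], so does [J]. *)
  have [K KA [eK fxK]] := edmonds_tightU1 indA xA nx.
  have KJ : K \subset J by apply: (bigcup_sup K); rewrite /tight KA eK eqxx.
  have := f_submod J (x |: K); rewrite setUCA (setUidPl KJ) fxK setUC.
  have : f K <= f (J :&: (x |: K)) by rewrite f_mono // subsetI KJ subsetUr.
  have : f J <= f (J :|: [set x]) by rewrite f_mono // subsetUl.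
  by lia.
(* This part of [B] has at most [f J] = #|J| elements, and the rest of [B] lies in [A :\: J]; hence
   #|B| <= #|A|. *)
have leBJ : #|(B :&: J) :|: (B :\: A)| <= f J.
  apply: leq_trans (leB _ _) _; first by rewrite subUset subsetIl subsetDl.
  by rewrite -[X in _ <= X]spanB f_mono // setSU // subsetIr.
have disj : (B :&: J) :&: (B :\: A) = set0.
  apply/setP => y; rewrite !inE; case yJ: (y \in J); last by rewrite andbF.
  by rewrite (subsetP JA) // !andbF.
have := cardsUI (B :&: J) (B :\: A); rewrite disj cards0.
have := cardsID A B; have := cardsID J (B :&: A).
rewrite -setIA (setIidPr JA).
have : #|B :&: A :\: J| <= #|A :\: J| by rewrite subset_leq_card // setSD // subsetIr.
have := cardsID J A; rewrite (setIidPr JA).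
by lia.
Qed.

Definition edmonds_matroid : matroid T := Matroid edmonds_matroid_axioms.

Lemma edmonds_mrank_leq : mrank edmonds_matroid <= f [set: T].
Proof.
apply/bigmax_leqP => I /andP[/edmonds_indepP indI _].
by apply: leq_trans (indI _ (subxx I)) (f_mono (subsetT I)).
Qed.

(** If a basis of [S] could not be extended by [x], some subset [J] of it would have
    [f (x |: J) = f J], against the hypothesis. *)
Lemma edmonds_flat (S : {set T}) :
  (forall J x, J \subset S -> x \notin S -> f J < f (x |: J)) ->
  flat edmonds_matroid S.
Proof.
move=> ltS; apply/forallP => x; apply/implyP => xS.
have [I indI [IS <-]] := rank_basis edmonds_matroid S.
have xI : x \notin I by apply: contraNN xS; apply: (subsetP IS).
have : x |: I \in indeps edmonds_matroid.
  apply/idPn => /(edmonds_tightU1 indI xI)[J JI [_ eJ]].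
  by have := ltS J x (subset_trans JI IS) xS; rewrite eJ ltnn.
by move/indep_leq_rank/(_ (setUS [set x] IS)); rewrite cardsU1 xI.
Qed.

End EdmondsMatroid.

(** * Placing elements freely on flats *)

Section FreePlacement.
Variables (T T' : finType) (M : matroid T') (P : T -> {set T'}).
Implicit Types (A B : {set T}).

Definition span_rank A : nat := rank M (\bigcup_(j in A) P j).

Lemma span_rank0 : span_rank set0 = 0.
Proof. by rewrite /span_rank big_set0 rank0. Qed.

Lemma span_rank_mono A B : A \subset B -> span_rank A <= span_rank B.
Proof.
move=> AB; apply/rank_mono/bigcupsP => j jA.
by apply: (bigcup_sup j); rewrite ?(subsetP AB).
Qed.

Lemma span_rank_submod A B :
  span_rank (A :|: B) + span_rank (A :&: B) <= span_rank A + span_rank B.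
Proof.
apply: leq_trans (rank_submod _ _ _); rewrite -bigcup_setU leq_add2l.
apply: rank_mono; apply/bigcupsP => j /setIP[jA jB].
by rewrite subsetI !(bigcup_sup j).
Qed.

(** By Rado's theorem, the independent sets are the subfamilies of [P] that have a transversal
    independent in [M]. *)
Definition free_placement : matroid T :=
  edmonds_matroid span_rank0 span_rank_mono span_rank_submod.

Lemma free_placement_mrank_leq : mrank free_placement <= mrank M.
Proof.
by apply: leq_trans (edmonds_mrank_leq _ _ _) _; apply/rank_mono/subsetT.
Qed.

(** An element [x] placed outside [F] brings a point [y] of [P x] not in [F], which raises the rank
    of any union of sets inside [F]. *)
Lemma free_placement_flat (F : {set T'}) :
  flat M F -> flat free_placement [set j | P j \subset F].
Proof.
move=> fF; apply: edmonds_flat => J x JS; rewrite inE => /subsetPn[y yP yF].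
have JF : \bigcup_(j in J) P j \subset F.
  by apply/bigcupsP => j /(subsetP JS); rewrite inE.
apply: leq_trans (flat_rank_lt fF JF yF) _.
apply: rank_mono; rewrite bigcup_setU big_set1 setSU //.
by rewrite sub1set.
Qed.

End FreePlacement.

(** * Bounding the minimum rank by means of an adjoint *)

Lemma mr_leq_mrank_adjoint (m n : nat) (X : pattern m n) (M : matroid 'I_m) :
  M \in matroids_of (X^T)%R -> has_adjoint M -> mr X <= mrank M.
Proof.
rewrite inE => /forallP ZM [T' [M' [_ eqr [phi [phi_flat phi_inj phi_rev _]]]]].
pose Z j := zero_set (X^T)%R j.
have fZ j : flat M (Z j) by have := ZM j; rewrite inE.
pose N := free_placement M' (fun j => phi (Z j)).
apply: leq_trans (_ : mrank N <= _); last first.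
  by rewrite -eqr free_placement_mrank_leq.
have [_] := mr_min X; apply; rewrite inE; apply/forallP => i; rewrite inE.
suff -> : zero_set X i = [set j | phi (Z j) \subset phi (closure M [set i])].
  apply: free_placement_flat.
  by have := phi_flat (closure M [set i]); rewrite !inE; apply; apply: flat_closure.
apply/setP => j; rewrite [RHS]inE.
by rewrite (phi_sub_closure1 eqr phi_flat phi_inj phi_rev) // !inE mxE.
Qed.

Theorem theorem4p10 (m n : nat) (X : pattern m n) :
  tri X < mr X ->
  forall M : matroid 'I_m,
    M \in matroids_of (X^T)%R -> mrank M = tri X -> ~ has_adjoint M.
Proof.
move=> lt_tri M MX eq_tri /(mr_leq_mrank_adjoint MX).
by rewrite eq_tri leqNgt lt_tri.
Qed.
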